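(* No infinite abelian group is a CI-group.
   Context: For a (possibly infinite) group $G$ and a subset $S\subseteq G\setminus\{e\}$ with $S=S^{-1}$ ($S$ not necessarily finite or generating), the Cayley graph $\mathrm{Cay}(G;S)$ has vertex set $G$, with $g$ adjacent to $gs$ for all $g\in G$, $s\in S$. The graph $\mathrm{Cay}(G;S)$ is a CI-graph if whenever $S'\subseteq G\setminus\{e\}$, $S'=S'^{-1}$, and $\mathrm{Cay}(G;S)\cong\mathrm{Cay}(G;S')$ as graphs, there is a group automorphism $\alpha$ of $G$ with $\alpha(S)=S'$. A group $G$ is a CI-group if every Cayley graph $\mathrm{Cay}(G;S)$ on $G$ is a CI-graph. *)

(* Defs.v *)
From HB Require Import structures.
From mathcomp Require Import all_boot monoid.
From mathcomp Require Import boolp classical_sets functions cardinality.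

Set Implicit Arguments.
Unset Strict Implicit.
Unset Printing Implicit Defensive.

Local Open Scope classical_set_scope.
Local Open Scope group_scope.

Definition connection_set (G : groupType) (S : set G) : Prop :=
  ~ S 1 /\ [set s^-1 | s in S] = S.

(* A graph on a vertex set V is given by its adjacency relation V -> V -> Prop.
   [cayley S] is loopless and symmetric when S is a connection set. *)
Definition cayley (G : groupType) (S : set G) : G -> G -> Prop :=
  fun g h => exists2 s, S s & h = g * s.

Definition graph_isomorphic (V W : Type)
    (E : V -> V -> Prop) (F : W -> W -> Prop) : Prop :=
  exists2 f : V -> W, bijective f & forall x y, E x y <-> F (f x) (f y).

Definition CI_graph (G : groupType) (S : set G) : Prop :=
  forall S' : set G, connection_set S' ->
    graph_isomorphic (cayley S) (cayley S') ->
    exists2 alpha : {multiplicative G -> G},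
      bijective alpha & alpha @` S = S'.

Definition CI_group (G : groupType) : Prop :=
  forall S : set G, connection_set S -> CI_graph S.

(* Main.v *)
Require Import Defs.
From HB Require Import structures.
From mathcomp Require Import all_boot monoid.
From mathcomp Require Import ssralg finalg countalg zmodp ring.
From mathcomp Require Import boolp classical_sets functions cardinality.

Local Open Scope classical_set_scope.
Local Open Scope group_scope.

Import GRing.Theory.

(** A group G is shown not to be CI by exhibiting two connection sets inside a
    countable or finite subgroup H whose Cayley graphs on H are isomorphic; the
    graphs on G are disjoint unions of copies of these, one for each coset of H,
    so they are isomorphic too ([graph_isomorphic_coset_extension]).  What has
    to be excluded is a group automorphism carrying one set to the other.  Which
    pair of sets works depends on the elements of order 2 and 3.

    If only finitely many g satisfy g ^+ 2 = 1 and only finitely many satisfy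
    g ^+ 3 = 1, take H countably infinite and let S be built greedily so that
    Cay(H; S) is the countable random graph.  The vertex added at each step
    only has to avoid finitely many values of its first three powers, and this
    leaves the freedom to ensure that S never contains both x and x ^+ 2.  Adjoining
    g, g ^+ 2 and their inverses to S for a suitable g in H changes S finitely,
    hence still gives the random graph ([back_and_forth]), but the new set
    does contain both g and g ^+ 2, a property that automorphisms preserve
    ([finite_torsion_not_CI]).

    Otherwise G contains every finite elementary abelian p-group for p = 2 or
    p = 3, and H is a finite one, of the form X * W * Z.  For phi : X -> W the
    shear (x, w, z) |-> (x, w + phi x, z) is not a group automorphism, but it
    turns the difference of two points lying over b in X into the difference
    translated by phi b, up to the subgroup D_b of W generated by the second
    differences phi (x + b) - phi x - phi b.  It is thus an isomorphism between
    the Cayley graphs of the sets that consist, over each nonzero b, of D_b for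
    the first and of phi b + D_b for the second, and of all nonzero points over
    0 for both ([twisted_set_shear]).  The factor Z is there to be large: it
    forces an automorphism matching the two sets to preserve the fibre W * Z.
    The automorphism then yields an additive l : X -> W with l b in phi b + D_b
    for all b ([twisted_set_automorphism]).  For a quadratic phi when p = 2, and
    a cubic phi when p = 3, no such l exists ([quadratic_twist_nonlinear],
    [cubic_twist_nonlinear]); the reason is that x ^ p = x makes a certain
    degree p form differ by a linear term from a form invariant under the
    translation by b = (1, 1, 1). *)

(** * Cayley graphs and cosets *)

Lemma cayleyE {G : groupType} (S : set G) g h : cayley S g h <-> S (g^-1 * h).
Proof.
split=> [[s Ss ->]|Sgh]; first by rewrite mulKg.
by exists (g^-1 * h); rewrite ?mulVKg.
Qed.

Lemma connection_setP {G : groupType} (S : set G) :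
  ~ S 1 -> (forall s, S s -> S s^-1) -> connection_set S.
Proof.
move=> S1 SV; split=> //; apply/seteqP; split=> [_ [s Ss <-]|s Ss]; first exact: SV.
by exists s^-1; [exact: SV|rewrite invgK].
Qed.

(** With S and S' inside the subgroup H = range iota, no edge joins two
    distinct left cosets of H.  Choosing a representative r of each coset, the
    map r * iota k |-> r * iota (f k) applies f on every coset separately. *)
Lemma graph_isomorphic_coset_extension {G : groupType} {K : Type} (iota : K -> G)
    (e : K) (f : K -> K) (S S' : set G) :
  injective iota -> iota e = 1 ->
  (forall j k, exists m, iota m = (iota j)^-1 * iota k) ->
  S `<=` range iota -> S' `<=` range iota -> bijective f ->
  (forall j k, S ((iota j)^-1 * iota k) <->
               S' ((iota (f j))^-1 * iota (f k))) ->
  graph_isomorphic (cayley S) (cayley S').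
Proof.
move=> iota_inj iota1 iotaF SH S'H [f' fK f'K] fE.
have iotaM j k : exists m, iota m = iota j * iota k.
  have [n] := iotaF j e; rewrite iota1 mulg1 => nE.
  by have [m] := iotaF n k; rewrite nE invgK; exists m.
pose coset g := [set r | exists k, g = r * iota k].
pose rep g := xget 1 (coset g).
have cosetM g k : coset (g * iota k) = coset g.
  apply/seteqP; split=> r [j].
    move=> /(canRL (mulgK _)) ->; have [n] := iotaF k e; rewrite iota1 mulg1 => <-.
    by have [m mE] := iotaM j n; exists m; rewrite mE mulgA.
  by move=> ->; have [m mE] := iotaM j k; exists m; rewrite mE mulgA.
have /choice[kap repE] : forall g, exists k, g = rep g * iota k.
  by move=> g; apply: (@xgetPex _ 1 (coset g)); exists g, e; rewrite iota1 mulg1.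
have repM g k : rep (g * iota k) = rep g by rewrite /rep cosetM.
have rep_rep g k : rep (rep g * iota k) = rep g.
  by rewrite repM -[in RHS](repM _ e) [in RHS](repE g) -mulgA iota1 mulg1 repM.
have kapM g k : kap (rep g * iota k) = k.
  by apply: iota_inj; apply: (mulgI (rep g)); rewrite -{1}(rep_rep g k) -repE.
pose move (u : K -> K) g := rep g * iota (u (kap g)).
have moveK (u v : K -> K) : cancel u v -> cancel (move u) (move v).
  by move=> uK g; rewrite /move rep_rep kapM uK -repE.
exists (move f); first by exists (move f'); apply: moveK.
move=> g h; rewrite !cayleyE.
(* Edges only occur inside a coset, and are read off in its coordinates. *)
have within x y (T : set G) : T `<=` range iota ->
    T ((rep g * iota x)^-1 * (rep h * iota y)) <->
    rep g = rep h /\ T ((iota x)^-1 * iota y).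
  move=> TH; split=> [Txy|[-> ]]; last by rewrite invgM -mulgA mulKg.
  have [m _ mE] := TH _ Txy.
  have ghE : rep g = rep h.
    by rewrite -(rep_rep g x) -(rep_rep h y) -(repM _ m) mE mulVKg.
  by split=> //; move: Txy; rewrite ghE invgM -mulgA mulKg.
rewrite {1}(repE g) {1}(repE h) !within //.
by split=> -[gh /fE].
Qed.

(** * Shears of finite abelian groups *)

(* Declares the product of two finite abelian groups as a finite abelian group. *)
HB.saturate prod.

Definition embedding {K : zmodType} {G : groupType} (iota : K -> G) : Prop :=
  injective iota /\ forall x y, iota (x + y)%R = iota x * iota y.

Definition additive_subgroup {W : zmodType} (P : W -> Prop) : Prop :=
  P 0%R /\ forall x y, P x -> P y -> P (x - y)%R.

Definition second_difference {X W : zmodType} (phi : X -> W) (b x : X) : W :=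
  (phi (x + b) - phi x - phi b)%R.

(** The subgroup D_b of W generated by the second differences at b, that is,
    the obstruction to phi (x + b) - phi x being constant in x. *)
Definition defect {X W : zmodType} (phi : X -> W) (b : X) (w : W) : Prop :=
  forall P, additive_subgroup P -> (forall x, P (second_difference phi b x)) -> P w.

Lemma additive_subgroupN {W : zmodType} (P : W -> Prop) x :
  additive_subgroup P -> P x -> P (- x)%R.
Proof. by move=> [P0 PB] Px; rewrite -[(- x)%R]add0r; apply: PB. Qed.

Lemma additive_subgroupD {W : zmodType} (P : W -> Prop) x y :
  additive_subgroup P -> P x -> P y -> P (x + y)%R.
Proof.
move=> PS Px Py; rewrite -[y]opprK.
by have [_ PB] := PS; apply: PB => //; apply: additive_subgroupN.
Qed.

Lemma defect_subgroup {X W : zmodType} (phi : X -> W) b :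
  additive_subgroup (defect phi b).
Proof.
split=> [P [] //|x y Px Py P PS Pd].
by have [_ PB] := PS; apply: PB; [apply: Px|apply: Py].
Qed.

Lemma second_difference_defect {X W : zmodType} (phi : X -> W) b x :
  defect phi b (second_difference phi b x).
Proof. by move=> P _; apply. Qed.

(** Needed for connection sets to be closed under inversion: a second difference
    at - b is a difference of two second differences at b. *)
Lemma defectN {X W : zmodType} (phi : X -> W) b :
  phi 0%R = 0%R -> defect phi (- b)%R `<=` defect phi b.
Proof.
move=> phi0 w; apply; first exact: defect_subgroup.
move=> x; have dS := defect_subgroup phi b.
have -> : second_difference phi (- b)%R x =
    (second_difference phi b (- b) - second_difference phi b (x - b))%R.
  rewrite /second_difference addNr phi0 sub0r subrK.
  by rewrite !opprB addrAC addrC !addrA subrK addrC addrA addrAC.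
by apply: (proj2 dS); apply: second_difference_defect.
Qed.

(** Over a base point b <> 0 this is the coset psi b + D_b inside W, and over 0
    it is the whole fibre W * Z without the origin.  It is used for psi = 0 and
    for psi = phi. *)
Definition twisted_set {X W Z : zmodType} (phi psi : X -> W) : set (X * (W * Z)) :=
  fun k => if k.1 == 0%R then k.2 <> 0%R
           else k.2.2 = 0%R /\ defect phi k.1 (k.2.1 - psi k.1)%R.

Lemma twisted_setN {X W Z : zmodType} (phi psi : X -> W) (k : X * (W * Z)) :
  phi 0%R = 0%R -> (forall b, defect phi b (psi (- b) + psi b)%R) ->
  twisted_set phi psi k -> twisted_set phi psi (- k)%R.
Proof.
case: k => x [w z] phi0 psiN; rewrite /twisted_set /= oppr_eq0.
case: ifPn => [_|_ [-> wD]]; first by apply: contra_not => /eqP;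
  rewrite (@oppr_eq0 (W * Z)%type) => /eqP.
split; first by rewrite oppr0.
rewrite -[x in defect _ x]opprK in wD.
have {}wD : defect phi (- x) (w - psi x)%R by exact: (@defectN _ _ phi _ phi0 _ wD).
have := psiN (- x)%R; rewrite opprK => pD.
have -> : (- w - psi (- x) = - (w - psi x) - (psi x + psi (- x)))%R.
  by rewrite opprB opprD addrA [(psi x - w)%R]addrC addrK.
have [_ dB] := defect_subgroup phi (- x)%R.
by apply: dB => //; exact: (additive_subgroupN _ _ (defect_subgroup _ _) wD).
Qed.

(** Replacing two points over y and y + b by their images under the shear adds
    phi (y + b) - phi y to their difference.  This equals phi b up to the second
    difference of phi at b and y, which D_b absorbs. *)
Lemma twisted_set_shear {X W Z : zmodType} (phi : X -> W) (j k : X * (W * Z)) :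
  let shear k := (k.1, (k.2.1 + phi k.1, k.2.2))%R : X * (W * Z) in
  twisted_set phi (fun=> 0%R) (k - j)%R <->
  twisted_set phi phi (shear k - shear j)%R.
Proof.
case: j k => [y [v t]] [x [w z]] /=; rewrite /twisted_set /=.
case: ifPn => [/eqP xy|_].
  have -> : x = y by apply/eqP; rewrite -subr_eq0 xy.
  have -> // : ((w, z) - (v, t) = (w + phi y, z) - (v + phi y, t) :> W * Z)%R.
  by congr (_, _); rewrite /= opprD addrACA subrr addr0.
have dS := defect_subgroup phi (x - y)%R.
set s := second_difference phi (x - y)%R y.
have sD : defect phi (x - y)%R s by apply: second_difference_defect.
have -> : (w + phi x - (v + phi y) - phi (x - y) = (w - v - 0) + s)%R.
  by rewrite subr0 /s /second_difference [(y + _)%R]addrC subrK opprD addrACA !addrA.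
split=> -[zt wv]; split=> //; first exact: (additive_subgroupD _ _ _ dS wv sD).
by rewrite -[X in defect _ _ X](addrK s); apply: (proj2 dS).
Qed.

(** If phi were additive the shear itself would be an automorphism; this says that
    phi is as good as additive for the purpose of matching twisted sets. *)
Definition linear_mod_defect {X W : zmodType} (phi : X -> W) : Prop :=
  exists2 l : X -> W, (forall x y, l (x + y) = l x + l y)%R &
    forall b, defect phi b (l b - phi b)%R.

(** First, beta preserves the fibre W * Z over 0.  If it moved some y of the fibre
    off it, then for each u in the fibre one of beta u and beta (y + u) would be
    off the fibre too; points of a twisted set off the fibre have no component
    in Z, and neither does beta y, so beta u would have none.  Then beta would
    embed W * Z into X * W, against the size of Z.  So beta induces an
    automorphism of X, and the components in W of the images of X give l after
    this automorphism is inverted. *)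
Lemma twisted_set_automorphism {X W Z : finZmodType} (phi : X -> W)
    (beta : X * (W * Z) -> X * (W * Z)) :
  #|X| < #|Z| -> phi 0%R = 0%R -> injective beta ->
  (forall j k, beta (j + k) = beta j + beta k)%R ->
  (forall k, twisted_set phi (fun=> 0%R) k -> twisted_set phi phi (beta k)) ->
  linear_mod_defect phi.
Proof.
move=> XZ phi0 beta_inj betaD betaT.
have beta0 : beta 0%R = 0%R.
  by apply: (addrI (beta 0%R)); rewrite -betaD !addr0.
have fibreT y : y != 0%R -> twisted_set phi phi (beta (0, y)%R).
  by by move=> /eqP y0; apply: betaT; rewrite /twisted_set eqxx.
have offT (k : X * (W * Z)) : twisted_set phi phi k -> k.1 != 0%R -> k.2.2 = 0%R.
  by move=> + k0; rewrite /twisted_set (negPf k0) => -[].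
have fibre y : (beta (0, y)%R).1 = 0%R.
  apply/eqP; apply: contraTT XZ => y1; rewrite -leqNgt.
  have y0 : y != 0%R by apply: contraNneq y1 => ->; rewrite beta0.
  have yz := offT _ (fibreT _ y0) y1.
  have allz u : (beta (0, u)%R).2.2 = 0%R.
    have [->|u0] := eqVneq u 0%R; first by rewrite beta0.
    have [u1|] := eqVneq (beta (0, u)%R).1 0%R; last exact/offT/fibreT.
    have E : beta (0, y + u)%R = (beta (0, y) + beta (0, u))%R.
      by rewrite -betaD; congr beta; congr (_, _); rewrite addr0.
    have yu1 : (beta (0, y + u)%R).1 != 0%R by rewrite E /= u1 addr0.
    have yu0 : (y + u != 0)%R by apply: contraNneq yu1 => ->; rewrite beta0.
    by have := offT _ (fibreT _ yu0) yu1; rewrite E /= yz add0r.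
  pose g (u : W * Z) := ((beta (0, u)%R).1, (beta (0, u)%R).2.1).
  have /leq_card : injective g.
    move=> u v [uv1 uv2]; suff /beta_inj[] : beta (0, u)%R = beta (0, v)%R by [].
    have := allz u; have := allz v; move: uv1 uv2.
    by case: (beta _) => [? [? ?]]; case: (beta _) => [? [? ?]] /= -> -> -> ->.
  have W0 : 0 < #|W| by apply/card_gt0P; exists 0%R.
  by rewrite !card_prod mulnC leq_pmul2r.
(* An injective self-map of the finite fibre is onto, so beta moves no point of
   the base into the fibre. *)
pose fib (y : W * Z) := (beta (0, y)%R).2.
have fib_inj : injective fib.
  move=> u v uv; suff /beta_inj[] : beta (0, u)%R = beta (0, v)%R by [].
  by rewrite [LHS]surjective_pairing [RHS]surjective_pairing !fibre; congr (_, _).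
have base0 x : (beta (x, 0)%R).1 = 0%R -> x = 0%R.
  move=> x0; have [fibV _ fibVK] := injF_bij fib_inj.
  suff /beta_inj[] : beta (x, 0)%R = beta (0, fibV (beta (x, 0)).2)%R by [].
  rewrite [LHS]surjective_pairing [RHS]surjective_pairing fibre x0.
  by congr (_, _); rewrite -[LHS]fibVK.
have betaD1 x y : beta (x + y, 0)%R = (beta (x, 0) + beta (y, 0))%R.
  by rewrite -betaD; congr beta; congr (_, _); rewrite addr0.
pose base x := (beta (x, 0)%R).1.
have baseD x y : base (x + y)%R = (base x + base y)%R by rewrite /base betaD1.
have base_inj : injective base.
  move=> x y /eqP; rewrite -subr_eq0 => /eqP xy; apply/eqP; rewrite -subr_eq0.
  apply/eqP/base0; rewrite -/(base _) -xy.
  by apply: (addIr (base y)); rewrite -baseD !subrK.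
have [baseV baseK baseVK] := injF_bij base_inj.
have baseVD x y : baseV (x + y)%R = (baseV x + baseV y)%R.
  by apply: base_inj; rewrite baseD !baseVK.
exists (fun b => (beta (baseV b, 0)%R).2.1) => [x y|b]; first by rewrite baseVD betaD1.
have [->|b0] := eqVneq b 0%R.
  have -> : baseV 0%R = 0%R by apply: base_inj; rewrite baseVK /base beta0.
  rewrite beta0 phi0 subr0; exact: (proj1 (defect_subgroup _ _)).
have : twisted_set phi phi (beta (baseV b, 0)%R).
  apply: betaT; rewrite /twisted_set /= ifN.
    by split=> //; rewrite subr0; apply: (proj1 (defect_subgroup _ _)).
  by apply: contraNneq b0 => bV0; rewrite -[b]baseVK bV0 /base beta0.
by rewrite /twisted_set -/(base _) baseVK (negPf b0) => -[].
Qed.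

Lemma embedding_divg {K : zmodType} {G : groupType} (iota : K -> G) :
  embedding iota -> forall j k, (iota j)^-1 * iota k = iota (k - j)%R.
Proof.
by move=> [_ iotaD] j k; apply: (canLR (mulKg _)); rewrite -iotaD addrC subrK.
Qed.

Lemma embedding0 {K : zmodType} {G : groupType} (iota : K -> G) :
  embedding iota -> iota 0%R = 1.
Proof. by move=> iotaP; rewrite -(subrr 0%R) -embedding_divg // mulVg. Qed.

Lemma embeddingN {K : zmodType} {G : groupType} (iota : K -> G) :
  embedding iota -> forall k, iota (- k)%R = (iota k)^-1.
Proof.
by move=> iotaP k; rewrite -[(- k)%R]add0r -embedding_divg // embedding0 // mulg1.
Qed.

Lemma embedding_image {K : zmodType} {G : groupType} (iota : K -> G) (T : set K) k :
  embedding iota -> (iota @` T) (iota k) = T k.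
Proof.
move=> [iota_inj _]; apply/propext.
by split=> [[j Tj /iota_inj <-] //|Tk]; exists k.
Qed.

Lemma embedding_connection_set {K : zmodType} {G : groupType} (iota : K -> G)
    (T : set K) :
  embedding iota -> ~ T 0%R -> (forall k, T k -> T (- k)%R) ->
  connection_set (iota @` T).
Proof.
move=> iotaP T0 TN; apply: connection_setP.
  by rewrite -(embedding0 iota) // embedding_image.
by move=> _ [k Tk <-]; rewrite -embeddingN // embedding_image //; apply: TN.
Qed.

(** The first twisted set together with 0 generates X * W * Z, so a group
    automorphism of G matching the two images restricts to an additive map
    beta of X * W * Z. *)
Lemma twist_not_CI {G : groupType} {X W Z : finZmodType} (phi : X -> W)
    (iota : X * (W * Z) -> G) :
  embedding iota -> #|X| < #|Z| -> phi 0%R = 0%R ->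
  ~ linear_mod_defect phi -> ~ CI_group G.
Proof.
move=> iotaP XZ phi0 phiN CI_G.
have [iota_inj iotaD] := iotaP.
pose T psi : set (X * (W * Z)) := twisted_set phi psi.
have T_conn psi : (forall b, defect phi b (psi (- b) + psi b)%R) ->
    connection_set (iota @` T psi).
  move=> psiN; apply: embedding_connection_set => //.
    by rewrite /T /twisted_set eqxx.
  by move=> k; apply: twisted_setN.
have dS b := defect_subgroup phi b.
have T0_conn : connection_set (iota @` T (fun=> 0%R)).
  by apply: T_conn => b; rewrite addr0; apply: (proj1 (dS b)).
have Tphi_conn : connection_set (iota @` T phi).
  apply: T_conn => b.
  have := additive_subgroupN _ _ (dS b) (second_difference_defect phi b (- b)%R).
  by rewrite /second_difference addNr phi0 sub0r opprB opprK addrC.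
have T_iso : graph_isomorphic (cayley (iota @` T (fun=> 0%R)))
                              (cayley (iota @` T phi)).
  apply: (@graph_isomorphic_coset_extension _ _ iota 0%R
    (fun k => (k.1, (k.2.1 + phi k.1, k.2.2))%R)) => //.
  - exact: embedding0.
  - by move=> j k; exists (k - j)%R; rewrite embedding_divg.
  - by move=> _ [k _ <-]; exists k.
  - by move=> _ [k _ <-]; exists k.
  - exists (fun k => (k.1, (k.2.1 - phi k.1, k.2.2))%R) => -[x [w z]] /=.
      by rewrite addrK.
    by rewrite subrK.
  - move=> j k; rewrite !embedding_divg // !embedding_image //.
    exact: twisted_set_shear.
have [alpha [alphaV alphaK _] alphaT] := CI_G _ T0_conn _ Tphi_conn T_iso.
have alpha_fibre y : exists m, alpha (iota (0, y)%R) = iota m.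
  have [->|/eqP y0] := eqVneq y 0%R.
    by exists 0%R; rewrite embedding0 //; apply: (mulgI (alpha 1)); rewrite -gmulfM !mulg1.
  have : (alpha @` (iota @` T (fun=> 0%R))) (alpha (iota (0, y)%R)).
    by exists (iota (0, y)%R) => //; exists (0, y)%R => //; rewrite /T /twisted_set eqxx.
  by rewrite alphaT => -[m _ <-]; exists m.
have alpha_base x : exists m, alpha (iota (x, 0)%R) = iota m.
  have [->|x0] := eqVneq x 0%R; first exact: alpha_fibre.
  have : (alpha @` (iota @` T (fun=> 0%R))) (alpha (iota (x, 0)%R)).
    exists (iota (x, 0)%R) => //; exists (x, 0)%R => //.
    by rewrite /T /twisted_set /= (negPf x0) subr0; split=> //; apply: (proj1 (dS x)).
  by rewrite alphaT => -[m _ <-]; exists m.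
have /choice[beta betaE] : forall k, exists m, alpha (iota k) = iota m.
  move=> [x y]; have [m mE] := alpha_base x; have [n nE] := alpha_fibre y.
  exists (m + n)%R; rewrite iotaD -mE -nE -gmulfM -iotaD.
  by congr (alpha (iota (_, _))); rewrite ?addr0 ?add0r.
apply: phiN; apply: (@twisted_set_automorphism X W Z phi beta) => //.
- move=> j k jk; apply/iota_inj/(can_inj alphaK).
  by rewrite !betaE jk.
- by move=> j k; apply: iota_inj; rewrite iotaD -!betaE iotaD gmulfM.
- move=> k Tk; suff : (iota @` T phi) (iota (beta k)) by rewrite embedding_image.
  by rewrite -alphaT -betaE; exists (iota k) => //; exists k.
Qed.

(** * Elementary abelian subgroups *)

Lemma embedding_of_kernel {K : zmodType} {G : groupType} (iota : K -> G) :
  (forall x y, iota (x + y)%R = iota x * iota y) ->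
  (forall x, iota x = 1 -> x = 0%R) -> embedding iota.
Proof.
move=> iotaD iota_ker; split=> // x y xy; apply/eqP; rewrite -subr_eq0; apply/eqP.
by apply: iota_ker; apply: (mulIg (iota y)); rewrite -iotaD subrK mul1g.
Qed.

Definition torsion (G : groupType) (p : nat) : set G := [set g | g ^+ p = 1].

Lemma expg_mod_torsion {G : groupType} p (g : G) n :
  torsion G p g -> g ^+ (n %% p) = g ^+ n.
Proof.
by move=> gp; rewrite {2}(divn_eq n p) expgnDr mulnC expgnA gp expg1n mul1g.
Qed.

(** Stated relative to an arbitrary finite A already embedded, so that the property
    passes to products and produces independent copies of B. *)
Definition extends_embeddings (G : groupType) (p : nat) (B : finZmodType) : Prop :=
  forall (A : finZmodType) (iota : A -> G),
    embedding iota -> (forall a, torsion G p (iota a)) ->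
  exists2 kappa : A * B -> G, embedding kappa & forall x, torsion G p (kappa x).

(** Any element g of order p outside the finite image of A generates a complement:
    a nonzero power of g lying in that image would put g itself there. *)
Lemma extends_embeddings_Fp {G : groupType} p :
  (forall x y : G, x * y = y * x) -> prime p -> infinite_set (torsion G p) ->
  extends_embeddings G p 'F_p.
Proof.
move=> G_abelian p_pr p_inf A iota iotaP iota_tor; have [_ iotaD] := iotaP.
have [g [gp gA]] : exists g, torsion G p g /\ ~ range iota g.
  apply: contrapT => gN; apply: p_inf; apply: (@sub_finite_set _ _ (range iota)).
    by move=> g gp; apply: contrapT => gA; apply: gN; exists g.
  exact/finite_image/finite_finset.
have gq : torsion G (Zp_trunc (pdiv p)).+2 g by rewrite Fp_cast.
have iotaX a n : iota (a *+ n)%R = iota a ^+ n.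
  elim: n => [|n IH]; first by rewrite mulr0n expg0 embedding0.
  by rewrite mulrS iotaD IH expgS.
exists (fun x : A * 'F_p => iota x.1 * g ^+ x.2); last first.
  move=> x; rewrite /torsion /= expgMn; last exact: G_abelian.
  by rewrite iota_tor -expgnA mulnC expgnA gp expg1n mulg1.
apply: embedding_of_kernel => [[a i] [b j]|[a i]] /=.
  have -> : iota a * g ^+ i * (iota b * g ^+ j) = iota a * iota b * g ^+ (i + j).
    by rewrite expgnDr -!mulgA; congr (_ * _); rewrite !mulgA [g ^+ i * _]G_abelian.
  by rewrite iotaD -[g ^+ (i + j)](expg_mod_torsion _ _ _ gq).
have [-> /=|i0 ai1] := eqVneq i 0%R.
  rewrite expg0 mulg1 -(embedding0 iota) // => a0.
  by congr (_, _); apply: (proj1 iotaP).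
case: gA; exists (- a *+ (i^-1)%R)%R => //.
rewrite iotaX embeddingN // (mulg1_eq ai1) -expgnA -(expg_mod_torsion _ _ _ gq).
have : (i * i^-1)%R = 1%R :> 'F_p by rewrite mulfV.
by move/(congr1 val) => /= ->; rewrite modn_small.
Qed.

Lemma extends_embeddings_prod {G : groupType} p (B C : finZmodType) :
  extends_embeddings G p B -> extends_embeddings G p C ->
  extends_embeddings G p (B * C)%type.
Proof.
move=> extB extC A iota iotaP iota_tor.
have [kappa kappaP kappa_tor] := extB A iota iotaP iota_tor.
have [mu [mu_inj muD] mu_tor] := extC _ kappa kappaP kappa_tor.
exists (fun x : A * (B * C) => mu ((x.1, x.2.1), x.2.2)) => //; split.
  by move=> [a [b c]] [a' [b' c']] /mu_inj[-> -> ->].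
by move=> [a [b c]] [a' [b' c']]; rewrite -muD.
Qed.

Lemma exists_embedding {G : groupType} p (B : finZmodType) :
  extends_embeddings G p B -> exists iota : B -> G, embedding iota.
Proof.
move=> extB.
have [||kappa [kappa_inj kappaD] _] := extB 'I_1 (fun=> 1).
- by split=> [x y _|x y]; rewrite ?mulg1 // [x]ord1 [y]ord1.
- by move=> _; rewrite /torsion /= expg1n.
exists (fun b => kappa (0%R, b)); split=> [b c /kappa_inj[]//|b c].
by rewrite -kappaD; congr kappa; congr (_, _); rewrite addr0.
Qed.

(** Taking Z = X * F_p makes Z larger than X. *)
Lemma torsion_twist_not_CI {G : groupType} p {X W : finZmodType} (phi : X -> W) :
  (forall x y : G, x * y = y * x) -> prime p -> infinite_set (torsion G p) ->
  extends_embeddings G p X -> extends_embeddings G p W ->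
  phi 0%R = 0%R ->
  ~ linear_mod_defect phi -> ~ CI_group G.
Proof.
move=> G_abelian p_pr p_inf extX extW.
have extF := extends_embeddings_Fp p G_abelian p_pr p_inf.
have extK := extends_embeddings_prod p _ _ extX
  (extends_embeddings_prod p _ _ extW (extends_embeddings_prod p _ _ extX extF)).
have [iota iotaP] := exists_embedding _ _ extK.
apply: (@twist_not_CI G X W (X * 'F_p)%type phi iota iotaP).
rewrite card_prod card_Fp // ltn_Pmulr ?prime_gt1 //.
by apply/card_gt0P; exists 0%R.
Qed.

(** * Twists for the primes 2 and 3 *)

(** How a candidate l is tested: a functional u for which u \o phi has a constant
    derivative in the direction b, necessarily u (phi b), kills D_b and so
    determines u (l b). *)
Lemma defect_functional {X W F : zmodType} (phi : X -> W) (u : W -> F) b w :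
  (forall x y, u (x - y) = u x - u y)%R ->
  (forall x, u (second_difference phi b x) = 0%R) ->
  defect phi b (w - phi b)%R -> u w = u (phi b).
Proof.
move=> uB usd wD; apply/eqP; rewrite -subr_eq0 -uB.
apply/eqP; apply: (wD (fun v => u v = 0%R)) => //; split=> [|x y ux uy].
  by rewrite -(subrr 0%R) uB subrr.
by rewrite uB ux uy subrr.
Qed.

Definition triples {F : eqType} (s : seq F) : seq (F * F * F) :=
  [seq (xy, z) | xy <- [seq (x, y) | x <- s, y <- s], z <- s].

Lemma all_triples {F : eqType} (s : seq F) (P : pred (F * F * F)) :
  (forall x, x \in s) -> all P (triples s) -> forall x, P x.
Proof.
by move=> sP /allP Ps [[x y] z]; apply: Ps; do 2![apply: allpairs_f => //].
Qed.

Lemma F2_enum (x : 'F_2) : x \in [:: 0; 1]%R.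
Proof. by case: x => [[|[|m]] lt_m]. Qed.

Lemma F3_enum (x : 'F_3) : x \in [:: 0; 1; -1]%R.
Proof. by case: x => [[|[|[|m]]] lt_m]. Qed.

Definition quadratic_twist (x : 'F_2 * 'F_2 * 'F_2) : 'F_2 * 'F_2 * 'F_2 :=
  (x.1.1 * x.1.2, x.1.1 * x.2, x.1.2 * x.2)%R.

(** The form xy + xz + yz equals (x + y)(x + z) + x because x ^ 2 = x, hence its
    derivative in the direction (1, 1, 1) is constant and equal to 1.  The same
    holds with constant 0 for xy, xz, yz in the direction of the absent basis
    vector, and for (x + y)z, (x + z)y and (y + z)x in the directions
    (1, 1, 0), (1, 0, 1) and (0, 1, 1).  Adding up these seven linear
    conditions on l cancels every value of l and leaves 0 = 1. *)
Lemma quadratic_twist_nonlinear : ~ linear_mod_defect quadratic_twist.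
Proof.
move=> [l lD lP].
pose u (i j k : 'F_2) (w : 'F_2 * 'F_2 * 'F_2) := (i * w.1.1 + j * w.1.2 + k * w.2)%R.
have ul i j k b :
    all (fun x => u i j k (second_difference quadratic_twist b x) == 0%R)
        (triples [:: 0; 1]%R) ->
    u i j k (l b) = u i j k (quadratic_twist b).
  move=> /(all_triples _ _ F2_enum) ub; apply: defect_functional (lP b).
    by move=> x y; rewrite /u /=; ring.
  by move=> x; apply/eqP; apply: ub.
pose e1 : 'F_2 * 'F_2 * 'F_2 := (1, 0, 0)%R.
pose e2 : 'F_2 * 'F_2 * 'F_2 := (0, 1, 0)%R.
pose e3 : 'F_2 * 'F_2 * 'F_2 := (0, 0, 1)%R.
have := ul 1%R 0%R 0%R e3 isT.
have := ul 0%R 1%R 0%R e2 isT.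
have := ul 0%R 0%R 1%R e1 isT.
have := ul 0%R 1%R 1%R (e1 + e2)%R isT.
have := ul 1%R 0%R 1%R (e1 + e3)%R isT.
have := ul 1%R 1%R 0%R (e2 + e3)%R isT.
have := ul 1%R 1%R 1%R (e1 + e2 + e3)%R isT.
rewrite !lD.
case: (l e1) (l e2) (l e3) => [[a1 b1] c1] [[a2 b2] c2] [[a3 b3] c3].
rewrite /u /quadratic_twist /=.
move=> E123 E23 E13 E12 E1 E2 E3.
(* E123 + E1 + E2 + E3 - (E12 + E13 + E23) has a vanishing left-hand side. *)
have := congr2 (fun x y => x - y)%R (congr2 +%R E123 (congr2 +%R E1 (congr2 +%R E2 E3)))
  (congr2 +%R E12 (congr2 +%R E13 E23)).
by rewrite [X in X = _](_ : _ = 0%R) /=; last by ring.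
Qed.

Lemma infinite_torsion2_not_CI {G : groupType} :
  (forall x y : G, x * y = y * x) -> infinite_set (torsion G 2) -> ~ CI_group G.
Proof.
move=> G_abelian G2_inf.
have extF := @extends_embeddings_Fp _ 2 G_abelian isT G2_inf.
have extM := @extends_embeddings_prod G 2.
have ext3 := extM _ _ (extM _ _ extF extF) extF.
apply: (@torsion_twist_not_CI G 2 _ _ quadratic_twist G_abelian isT G2_inf ext3 ext3).
  by rewrite /quadratic_twist !mulr0.
exact: quadratic_twist_nonlinear.
Qed.

(** Naming the finite group structures keeps products from being unified through
    different paths of the algebraic hierarchy, a computation that grows quickly
    with the number of factors. *)
Definition F3_triple : finZmodType := ('F_3 * 'F_3 * 'F_3)%type.
Definition F3_quintuple : finZmodType := ('F_3 * 'F_3 * 'F_3 * 'F_3 * 'F_3)%type.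

Definition cubic_twist (v : F3_triple) : F3_quintuple :=
  let x := v.1.1 in let y := v.1.2 in let z := v.2 in
  (x ^+ 2 * y, x * y ^+ 2, x ^+ 2 * z, x * y * z, y ^+ 2 * z)%R.

(** Since x ^ 3 = x, the forms (x - y)^2 (x - z) - x and (x + y)^2 (x - z) - x are
    spanned by the five monomials of the twist.  In the directions (1, 1, 1) and
    (1, -1, 1) respectively, their first parts are invariant, so their
    derivatives are constant, equal to -1.  The other conditions come from forms
    invariant in the given direction: a monomial lacking a variable, the forms
    (x + y)^2 z and (x - y)^2 z, and y^2 (x - z), x^2 (y - z).  A combination of
    these conditions cancels every value of l and leaves 0 = -2. *)
Lemma cubic_twist_nonlinear : ~ linear_mod_defect cubic_twist.
Proof.
move=> [l lD lP].
pose u (i j k m n : 'F_3) (w : F3_quintuple) :=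
  (i * w.1.1.1.1 + j * w.1.1.1.2 + k * w.1.1.2 + m * w.1.2 + n * w.2)%R.
have ul i j k m n b :
    all (fun x => u i j k m n (second_difference cubic_twist b x) == 0%R)
        (triples [:: 0; 1; -1]%R) ->
    u i j k m n (l b) = u i j k m n (cubic_twist b).
  move=> /(all_triples _ _ F3_enum) ub; apply: defect_functional (lP b).
    by move=> x y; rewrite /u /=; ring.
  by move=> x; apply/eqP; apply: ub.
pose e1 : F3_triple := (1, 0, 0)%R.
pose e2 : F3_triple := (0, 1, 0)%R.
pose e3 : F3_triple := (0, 0, 1)%R.
have := ul 1%R 0%R 0%R 0%R 0%R e3 isT.
have := ul 0%R 0%R 1%R 0%R 0%R e2 isT.
have := ul 0%R 0%R 0%R 0%R 1%R e1 isT.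
have := ul 0%R 0%R 1%R 1%R 1%R (e1 + e2)%R isT.
have := ul 0%R 0%R 1%R (-1)%R 1%R (e1 - e2)%R isT.
have := ul 0%R 1%R 0%R 0%R (-1)%R (e1 + e3)%R isT.
have := ul 1%R 0%R (-1)%R 0%R 0%R (e2 + e3)%R isT.
have := ul 1%R 1%R (-1)%R (-1)%R (-1)%R (e1 + e2 + e3)%R isT.
have := ul (-1)%R 1%R (-1)%R 1%R (-1)%R (e1 - e2 + e3)%R isT.
have lN x : l (- x)%R = (- l x)%R.
  by apply: (addrI (l x)); rewrite -lD !subrr; apply: (addrI (l 0%R)); rewrite -lD !addr0.
rewrite !lD !lN.
case: (l e1) (l e2) (l e3) => [[[[a1 b1] d1] x1] f1] [[[[a2 b2] d2] x2] f2] [[[[a3 b3] d3] x3] f3].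
rewrite /u /cubic_twist /=.
move=> M3 M1 E4 E3 E2 E1 Zf Zd Za.
have double (x y : 'F_3) : (x = y -> x + x = y + y)%R by move=> ->.
(* The sum M1 + M3 + E1 + E2 + 2 Za - 2 (E3 + E4 + Zf + Zd): its left-hand side
   vanishes identically. *)
have := congr2 (fun x y => x - y)%R
  (congr2 +%R (congr2 +%R M1 M3) (congr2 +%R (congr2 +%R E1 E2) (double _ _ Za)))
  (congr2 +%R (congr2 +%R (double _ _ E3) (double _ _ E4))
              (congr2 +%R (double _ _ Zf) (double _ _ Zd))).
by rewrite [X in X = _](_ : _ = 0%R) /=; last by ring.
Qed.

Lemma infinite_torsion3_not_CI {G : groupType} :
  (forall x y : G, x * y = y * x) -> infinite_set (torsion G 3) -> ~ CI_group G.
Proof.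
move=> G_abelian G3_inf.
have extF := @extends_embeddings_Fp _ 3 G_abelian isT G3_inf.
have extM := @extends_embeddings_prod G 3.
have ext3 : extends_embeddings G 3 F3_triple := extM _ _ (extM _ _ extF extF) extF.
have ext5 : extends_embeddings G 3 F3_quintuple := extM _ _ (extM _ _ ext3 extF) extF.
apply: (@torsion_twist_not_CI G 3 F3_triple F3_quintuple cubic_twist G_abelian isT G3_inf ext3 ext5).
  by rewrite /cubic_twist /= !expr0n !mulr0.
exact: cubic_twist_nonlinear.
Qed.

(** * The countable random graph *)

(** The axiom characterizing the countable random graph, on the vertex set nat. *)
Definition extension_property (E : nat -> nat -> Prop) : Prop :=
  forall U W : seq nat, (forall x, x \in U -> x \notin W) ->
  exists z, [/\ z \notin U, z \notin W, forall u, u \in U -> E z u &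
                forall w, w \in W -> ~ E z w].

Definition partial_isomorphism (E F : nat -> nat -> Prop) (s : seq (nat * nat)) : Prop :=
  forall p q, p \in s -> q \in s ->
    (p.1 = q.1 <-> p.2 = q.2) /\ (E p.1 q.1 <-> F p.2 q.2).

Definition symmetric_loopless (E : nat -> nat -> Prop) : Prop :=
  (forall x, ~ E x x) /\ (forall x y, E x y -> E y x).

Definition flip (p : nat * nat) := (p.2, p.1).

Lemma partial_isomorphism_flip E F s :
  partial_isomorphism E F s -> partial_isomorphism F E (map flip s).
Proof.
move=> sP _ _ /mapP[p ps ->] /mapP[q qs ->] /=.
by have [-> ->] := sP p q ps qs.
Qed.

(** The image of the new vertex x has to be joined to exactly the images of the
    neighbours of x, which the extension property provides. *)
Lemma partial_isomorphism_forth E F s x :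
  symmetric_loopless E -> symmetric_loopless F -> extension_property F ->
  partial_isomorphism E F s -> exists y, partial_isomorphism E F ((x, y) :: s).
Proof.
move=> [Eirr Esym] [Firr Fsym] Fext sP.
have [/mapP[[x' y] xys /= ->]|xs] := boolP (x \in map fst s).
  by exists y => p q; rewrite !inE => /predU1P[->|ps] /predU1P[->|qs]; apply: sP.
pose U := [seq p.2 | p <- s & `[<E x p.1>]].
pose W := [seq p.2 | p <- s & ~~ `[<E x p.1>]].
have [|y [yU yW yE yN]] := Fext U W.
  move=> _ /mapP[p + ->]; rewrite mem_filter => /andP[/asboolP xp ps].
  apply/negP => /mapP[q]; rewrite mem_filter => /andP[/asboolPn xq qs].
  by move=> /(proj1 (sP p q ps qs)) pq; rewrite -pq in xq.
have new p : p \in s -> (x = p.1 <-> y = p.2) /\ (E x p.1 <-> F y p.2).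
  move=> ps; split.
    split=> [xp|yp]; first by case/mapP: xs; exists p.
    have [xp|xp] := asboolP (E x p.1).
      by case/mapP: yU; exists p; rewrite // mem_filter ps andbT; apply/asboolP.
    by case/mapP: yW; exists p; rewrite // mem_filter ps andbT; apply/asboolPn.
  have [xp|xp] := asboolP (E x p.1); split=> //.
    by move=> _; apply/yE/mapP; exists p; rewrite // mem_filter ps andbT; apply/asboolP.
  by move=> /yN[]; apply/mapP; exists p; rewrite // mem_filter ps andbT; apply/asboolPn.
exists y => p q; rewrite !inE => /predU1P[->|ps] /predU1P[->|qs] /=.
- by split; split=> // /[dup] => [/Eirr|/Firr].
- exact: new.
- have [xp Exp] := new p ps; split.
    by split=> [/esym/xp|/esym/xp] ->.
  by split=> [/Esym/Exp/Fsym|/Fsym/Exp/Esym].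
- exact: sP.
Qed.

Lemma partial_isomorphism_step E F s n :
  symmetric_loopless E -> symmetric_loopless F ->
  extension_property E -> extension_property F ->
  partial_isomorphism E F s ->
  exists s', [/\ partial_isomorphism E F s', {subset s <= s'},
                 n \in map fst s' & n \in map snd s'].
Proof.
move=> Eg Fg Ee Fe sP.
have [y yP] := partial_isomorphism_forth _ _ _ n Eg Fg Fe sP.
have [x /partial_isomorphism_flip xP] :=
  partial_isomorphism_forth _ _ _ n Fg Eg Ee (partial_isomorphism_flip _ _ _ yP).
have flipK : map flip (map flip ((n, y) :: s)) = (n, y) :: s.
  by rewrite -map_comp map_id_in // => -[].
move: xP; rewrite map_cons flipK => xP.
exists [:: flip (n, x), (n, y) & s]; split=> //.
- by move=> p ps; rewrite !inE ps !orbT.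
- by rewrite /= !inE eqxx orbT.
- by rewrite /= !inE eqxx.
Qed.

(** The n-th step of the chain R puts n both in the domain and in the range, so
    the union of the chain is the graph of a bijection. *)
Lemma back_and_forth E F :
  symmetric_loopless E -> symmetric_loopless F ->
  extension_property E -> extension_property F ->
  exists2 f : nat -> nat, bijective f & forall x y, E x y <-> F (f x) (f y).
Proof.
move=> Eg Fg Ee Fe.
have /choice[next nextP] : forall sn : seq (nat * nat) * nat, exists s',
    partial_isomorphism E F sn.1 ->
    [/\ partial_isomorphism E F s', {subset sn.1 <= s'},
        sn.2 \in map fst s' & sn.2 \in map snd s'].
  move=> [s n]; have [sP|sN] := pselect (partial_isomorphism E F s); last by exists s.
  by have [s' s'P] := partial_isomorphism_step _ _ s n Eg Fg Ee Fe sP; exists s'.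
pose R := fix R n := if n is m.+1 then next (R m, m) else [::].
have RP n : partial_isomorphism E F (R n).
  by elim: n => [//|n IH]; have [] := nextP (R n, n) IH.
have Rmono m n p : m <= n -> p \in R m -> p \in R n.
  move=> /subnK <-; elim: (n - m) => [//|k IH] /IH; rewrite addSn.
  by have [_ + _ _] := nextP (R (k + m), (k + m)%N) (RP _); apply.
have Rsame m n p q : p \in R m -> q \in R n ->
    (p.1 = q.1 <-> p.2 = q.2) /\ (E p.1 q.1 <-> F p.2 q.2).
  by move=> pm qn; apply: (RP (maxn m n)); [apply: Rmono pm|apply: Rmono qn];
    rewrite ?leq_maxl ?leq_maxr.
have /choice[f fP] : forall x, exists y, (x, y) \in R x.+1.
  move=> x; have [_ _ /mapP[[x' y] xy /= xE] _] := nextP (R x, x) (RP x).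
  by exists y; rewrite [in (x, y)]xE.
have /choice[g gP] : forall y, exists x, (x, y) \in R y.+1.
  move=> y; have [_ _ _ /mapP[[x y'] xy /= yE]] := nextP (R y, y) (RP y).
  by exists x; rewrite [in (x, y)]yE.
exists f; last by move=> x y; have [] := Rsame _ _ _ _ (fP x) (fP y).
exists g => [x|y].
  by have [[_ inj] _] := Rsame _ _ _ _ (gP (f x)) (fP x); apply: inj.
by have [[fn _] _] := Rsame _ _ _ _ (fP (g y)) (gP y); apply: fn.
Qed.

(** * Random Cayley graphs without squares *)

(** The solutions of x ^+ k = b, if any, form a coset of the k-torsion. *)
Lemma finite_roots {G : groupType} k (B : seq G) :
  (forall x y : G, x * y = y * x) -> finite_set (torsion G k) ->
  finite_set [set x : G | x ^+ k \in B].
Proof.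
move=> G_abelian Gk; apply: (@sub_finite_set _ _ (\bigcup_(b in [set` B]) [set x | x ^+ k = b])).
  by move=> x xB; exists (x ^+ k).
apply: bigcup_finite => // b _.
have [[a ab]|aN] := pselect (exists a, a ^+ k = b); last first.
  by apply: (@sub_finite_set _ _ set0) => // x xb; apply: aN; exists x.
apply: sub_finite_set (finite_image (fun t => a * t) Gk) => x /= xb.
exists (a^-1 * x); last by rewrite mulVKg.
by rewrite /torsion /= expgMn; [rewrite expVgn ab xb mulVg|apply: G_abelian].
Qed.

Lemma exists_avoiding_powers {G : groupType} (iota : nat -> G) (B1 B2 B3 : seq G) :
  (forall x y : G, x * y = y * x) -> injective iota ->
  finite_set (torsion G 2) -> finite_set (torsion G 3) ->
  exists n, [/\ iota n \notin B1, iota n ^+ 2 \notin B2 & iota n ^+ 3 \notin B3].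
Proof.
move=> G_abelian iota_inj G2 G3; apply: contrapT => nN; apply: infinite_nat.
pose bad := [set` B1] `|` [set x : G | x ^+ 2 \in B2] `|` [set x | x ^+ 3 \in B3].
have bad_fin : finite_set bad.
  by rewrite !finite_setU; do !split; [|exact: finite_roots|exact: finite_roots].
apply: (@sub_finite_set _ _ (iota @^-1` bad)); last first.
  by apply: finite_preimage => // x y _ _; apply: iota_inj.
move=> n _; apply: contrapT => nbad.
apply: nN; exists n; split; apply/negP => nB; apply: nbad.
- by left; left.
- by left; right.
- by right.
Qed.

Definition symmetrized {G : groupType} (s : seq G) : seq G := s ++ [seq x^-1 | x <- s].

Lemma symmetrizedP {G : groupType} (s : seq G) x :
  x \in symmetrized s -> x \in s \/ x^-1 \in s.
Proof.
rewrite mem_cat => /orP[|/mapP[y ys ->]]; first by left.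
by right; rewrite invgK.
Qed.

Lemma symmetrizedV {G : groupType} (s : seq G) x :
  x \in symmetrized s -> x^-1 \in symmetrized s.
Proof.
rewrite !mem_cat => /orP[xs|/mapP[y ys ->]]; last by rewrite invgK ys.
by rewrite map_f ?orbT.
Qed.

(** Finite approximations of the set to be built: s.1 lists elements decided to be
    in it, s.2 elements decided to be outside. *)
Definition stage {G : groupType} (iota : nat -> G) (s : seq G * seq G) : Prop :=
  [/\ forall x, x \in s.1 -> range iota x, forall x, x \in s.1 -> x^-1 \in s.1 &
      forall x, x \in s.1 -> x ^+ 2 \notin s.1] /\
  [/\ 1 \in s.2, forall x, x \in s.2 -> x^-1 \in s.2 &
      forall x, x \in s.1 -> x \notin s.2].

(** The new vertex t = iota z must be adjacent to the points of U and not to those of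
    W, so every t^-1 * u is put in, every t^-1 * w out, with their inverses.
    Each way in which this may break the conditions on a stage is an equation
    fixing t, t ^+ 2 or t ^+ 3 in terms of finitely many known elements, so a
    generic t satisfies them all. *)
Lemma stage_extension {G : groupType} (iota : nat -> G) (s : seq G * seq G)
    (U W F : seq nat) :
  (forall x y : G, x * y = y * x) -> injective iota ->
  (forall j k, exists m, iota m = (iota j)^-1 * iota k) ->
  finite_set (torsion G 2) -> finite_set (torsion G 3) ->
  (forall x, x \in U -> x \notin W) -> stage iota s ->
  exists z, z \notin F /\ exists s',
    [/\ stage iota s', {subset s.1 <= s'.1}, {subset s.2 <= s'.2},
        forall u, u \in U -> (iota z)^-1 * iota u \in s'.1 &
        forall w, w \in W -> (iota z)^-1 * iota w \in s'.2].
Proof.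
move=> G_abelian iota_inj iotaF G2 G3 UW [[LH LV Lsq] [N1 NV LN]].
case: s => L N /= in LH LV Lsq N1 NV LN *.
set IU := map iota U; set IW := map iota W.
have [z []] := exists_avoiding_powers iota
  (map iota F ++ [seq u * n^-1 | u <- IU, n <- N] ++ [seq w * l^-1 | w <- IW, l <- L] ++
   [seq u * (l ^+ 2)^-1 | u <- IU, l <- L] ++ [seq u ^+ 2 * u'^-1 | u <- IU, u' <- IU])
  ([seq u * w | u <- IU, w <- IW] ++ [seq u ^+ 2 * l^-1 | u <- IU, l <- L])
  [seq u ^+ 2 * u' | u <- IU, u' <- IU] G_abelian iota_inj G2 G3.
rewrite !mem_cat !negb_or => /and5P[zF zUN zWL zUL zUU] /andP[z2UW z2UL] z3.
set t := iota z in zF zUN zWL zUL zUU z2UW z2UL z3.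
pose A := symmetrized [seq t^-1 * u | u <- IU].
pose B := symmetrized [seq t^-1 * w | w <- IW].
have solve (a u x : G) : a^-1 * u = x -> a = u * x^-1.
  by move=> <-; rewrite invgM invgK mulVKg.
have AV x : x \in A -> exists2 u, u \in IU & t^-1 * u = x \/ t^-1 * u = x^-1.
  by case/symmetrizedP => /mapP[u uU xE]; exists u; rewrite // -xE; [left|right].
have BV x : x \in B -> exists2 w, w \in IW & t^-1 * w = x \/ t^-1 * w = x^-1.
  by case/symmetrizedP => /mapP[w wW xE]; exists w; rewrite // -xE; [left|right].
have AsV x : x \in A -> x^-1 \in A by apply: symmetrizedV.
have BsV x : x \in B -> x^-1 \in B by apply: symmetrizedV.
have memAL x : (x \in A ++ L) = (x \in A) || (x \in L) by rewrite mem_cat.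
have memBN x : (x \in B ++ N) = (x \in B) || (x \in N) by rewrite mem_cat.
have ALV x : x \in A ++ L -> x^-1 \in A ++ L.
  by rewrite !memAL => /orP[/AsV|/LV] ->; rewrite ?orbT.
have BNV x : x \in B ++ N -> x^-1 \in B ++ N.
  by rewrite !memBN => /orP[/BsV|/NV] ->; rewrite ?orbT.
have expM k u : (t^-1 * u) ^+ k = (t ^+ k)^-1 * u ^+ k.
  by rewrite expgMn ?expVgn //; apply: G_abelian.
have Asq u : u \in IU -> (t^-1 * u) ^+ 2 \notin A ++ L.
  move=> uU; rewrite memAL negb_or; apply/andP; split; apply/negP; last first.
    rewrite expM => uL; case/negP: z2UL.
    by rewrite (solve (t ^+ 2) (u ^+ 2) _ erefl); apply: allpairs_f.
  case/AV=> u' u'U [uu|uu].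
    case/negP: zUU; rewrite (solve t (u ^+ 2) u'); first by apply: allpairs_f.
    move: uu; rewrite expM => /(canRL (mulVKg _)) ->.
    by rewrite !expg2 invgM !mulgA mulgV mul1g.
  case/negP: z3; suff -> : t ^+ 3 = u ^+ 2 * u' by apply: allpairs_f.
  move: uu; rewrite expM invgM invgK => /(canRL (mulVKg _)) ->.
  by rewrite mulgA [u ^+ 2 * t]G_abelian -mulgA mulVKg -expgS.
have AN u : u \in IU -> t^-1 * u \notin B ++ N.
  move=> uU; rewrite memBN negb_or; apply/andP; split; apply/negP; last first.
    by move=> uN; case/negP: zUN; rewrite (solve t u _ erefl); apply: allpairs_f.
  case/BV=> w wW [/mulgI wu|wu].
    case/mapP: uU wW => k kU uE; rewrite wu uE => /mapP[m mW /iota_inj km].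
    by move/negP: (UW k kU); rewrite km.
  case/negP: z2UW; suff -> : t ^+ 2 = u * w by apply: allpairs_f.
  move: wu; rewrite invgM invgK => /(canRL (mulVKg _)) ->.
  by rewrite mulgA [u * t]G_abelian -mulgA mulVKg.
exists z; split; first by apply: contraNN zF => /map_f; apply.
exists (A ++ L, B ++ N) => /=; split.
- split; split.
  + move=> x; rewrite memAL => /orP[|/LH//] /symmetrizedP[]/mapP[_ /mapP[k _ ->] xE].
      by have [m mE] := iotaF z k; exists m; rewrite // xE.
    have [m mE] := iotaF k z; exists m; rewrite // mE.
    by apply: invg_inj; rewrite xE invgM invgK.
  + by move=> x; rewrite !memAL => /orP[/AsV|/LV] ->; rewrite ?orbT.
  + move=> x; rewrite memAL => /orP[/AV[u uU [ux|ux]]|xL].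
    * by rewrite -ux; apply: Asq.
    * apply: contra (Asq u uU) => /ALV; rewrite ux.
      by rewrite expVgn.
    * rewrite memAL negb_or Lsq // andbT; apply/negP => /AV[u uU [ux|ux]].
        by case/negP: zUL; rewrite (solve t _ _ ux); apply: allpairs_f.
      by case/negP: zUL; rewrite (solve t _ _ ux) -expVgn; apply: allpairs_f; rewrite ?LV.
  + by rewrite memBN N1 orbT.
  + by move=> x; rewrite !memBN => /orP[/BsV|/NV] ->; rewrite ?orbT.
  + move=> x; rewrite memAL => /orP[/AV[u uU [<-|ux]]|xL]; first exact: AN.
      by apply: contra (AN u uU) => /BNV; rewrite -ux.
    rewrite memBN negb_or LN // andbT; apply/negP => /BV[w wW [wx|wx]].
      by case/negP: zWL; rewrite (solve t _ _ wx); apply: allpairs_f.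
    by case/negP: zWL; rewrite (solve t _ _ wx); apply: allpairs_f; rewrite ?LV.
- by move=> x xL; rewrite memAL xL orbT.
- by move=> x xN; rewrite memBN xN orbT.
- by move=> u uU; rewrite !mem_cat !map_f.
- by move=> w wW; rewrite !mem_cat !map_f.
Qed.

(** The extension property of the Cayley graph on range iota, with the additional
    freedom to keep z out of a finite set F, which makes it robust under finite
    changes of S. *)
Definition universal {G : groupType} (iota : nat -> G) (S : set G) : Prop :=
  forall U W F : seq nat, (forall x, x \in U -> x \notin W) ->
  exists z, [/\ z \notin F, forall u, u \in U -> S ((iota z)^-1 * iota u) &
                forall w, w \in W -> ~ S ((iota z)^-1 * iota w)].

(** All triples (U, W, F) are listed, and the n-th stage takes care of the n-th
    triple. *)
Lemma exists_universal_without_squares {G : groupType} (iota : nat -> G) :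
  (forall x y : G, x * y = y * x) -> injective iota ->
  (forall j k, exists m, iota m = (iota j)^-1 * iota k) ->
  finite_set (torsion G 2) -> finite_set (torsion G 3) ->
  exists S : set G, [/\ S `<=` range iota, ~ S 1, forall x, S x -> S x^-1,
                        forall x, S x -> ~ S (x ^+ 2) & universal iota S].
Proof.
move=> G_abelian iota_inj iotaF G2 G3.
pose task := (seq nat * seq nat * seq nat)%type.
pose meets (r : task) (s s' : seq G * seq G) :=
  (forall x, x \in r.1.1 -> x \notin r.1.2) ->
  exists z, [/\ z \notin r.2, forall u, u \in r.1.1 -> (iota z)^-1 * iota u \in s'.1 &
                forall w, w \in r.1.2 -> (iota z)^-1 * iota w \in s'.2].
have /choice[next nextP] : forall rs : task * (seq G * seq G), exists s',
    stage iota rs.2 -> [/\ stage iota s', {subset rs.2.1 <= s'.1},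
                           {subset rs.2.2 <= s'.2} & meets rs.1 rs.2 s'].
  move=> [[[U W] F] s] /=.
  have [sP|sN] := pselect (stage iota s); last by exists s.
  have [UW|UW] := pselect (forall x, x \in U -> x \notin W); last by exists s; split=> // /UW.
  have [z [zF [s' [s'P LL NN zU zW]]]] :=
    stage_extension iota s U W F G_abelian iota_inj iotaF G2 G3 UW sP.
  by exists s' => _; split=> // _; exists z.
pose task_of n : task := odflt ([::], [::], [::]) (unpickle n).
pose s := fix s n := if n is m.+1 then next (task_of m, s m) else ([::], [:: 1 : G]).
have sP n : stage iota (s n).
  elim: n => [|n IH]; last by have [] := nextP (task_of n, s n) IH.
  split; split=> //; first by rewrite inE.
  by move=> x; rewrite !inE => /eqP ->; rewrite invg1.
have sS n := nextP (task_of n, s n) (sP n).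
have mono m n : m <= n -> {subset (s m).1 <= (s n).1} /\ {subset (s m).2 <= (s n).2}.
  move=> /subnK <-; elim: (n - m) => [|k [IH1 IH2]]; first by split=> x.
  have [_ h1 h2 _] := sS (k + m)%N.
  by split=> x xs; [apply/h1/IH1|apply/h2/IH2].
have disj m n x : x \in (s m).1 -> x \in (s n).2 -> False.
  move=> xm xn; have [_ [_ _ LN]] := sP (maxn m n).
  have /LN/negP[] : x \in (s (maxn m n)).1.
    by apply: (proj1 (mono m _ _)) xm; apply: leq_maxl.
  by apply: (proj2 (mono n _ _)) xn; apply: leq_maxr.
exists [set x | exists n, x \in (s n).1]; split=> /=.
- by move=> x [n]; have [[LH _ _] _] := sP n; apply: LH.
- by move=> [n] /disj; apply; have [_ [N1 _ _]] := sP n; apply: N1.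
- by move=> x [n xn]; exists n; have [[_ LV _] _] := sP n; apply: LV.
- move=> x [m xm] [n xn]; have [[_ _ Lsq] _] := sP (maxn m n).
  have /Lsq/negP[] : x \in (s (maxn m n)).1.
    by apply: (proj1 (mono m _ _)) xm; apply: leq_maxl.
  by apply: (proj1 (mono n _ _)) xn; apply: leq_maxr.
- move=> U W F UW; pose n := pickle ((U, W, F) : task).
  have nE : task_of n = (U, W, F) by rewrite /task_of pickleK.
  have [_ _ _] := sS n; rewrite -[next _]/(s n.+1) nE => /(_ UW)[z [zF zU zW]].
  exists z; split=> // [u uU|w wW [m]]; first by exists n.+1; apply: zU.
  by move=> /disj; apply; apply: (zW w wW).
Qed.

(** A point z joined to w only through an added element m satisfies
    z = w * m^-1, so finitely many z have to be avoided. *)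
Lemma universal_setU {G : groupType} (iota : nat -> G) (S : set G) (M : seq nat) :
  (forall x y : G, x * y = y * x) -> injective iota ->
  (forall j k, exists m, iota m = (iota j)^-1 * iota k) ->
  universal iota S -> universal iota (S `|` [set` map iota M]).
Proof.
move=> G_abelian iota_inj iotaF Suniv U W F UW.
have /choice[q qE] : forall wm : nat * nat, exists k,
    iota k = (iota wm.2)^-1 * iota wm.1 by move=> wm; apply: iotaF.
have [z [zF zU zW]] := Suniv U W (F ++ [seq q (w, m) | w <- W, m <- M]) UW.
move: zF; rewrite mem_cat negb_or => /andP[zF zq].
exists z; split=> // [u uU|w wW [|/mapP[m mM zw]]]; [by left; apply: zU|exact: zW|].
case/negP: zq; suff -> : z = q (w, m) by apply: allpairs_f.
apply: iota_inj; rewrite qE /= -zw invgM invgK.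
by rewrite G_abelian mulVKg.
Qed.

Lemma universal_graph_isomorphic {G : groupType} (iota : nat -> G) (e : nat)
    (S S' : set G) :
  injective iota -> iota e = 1 ->
  (forall j k, exists m, iota m = (iota j)^-1 * iota k) ->
  S `<=` range iota -> S' `<=` range iota ->
  ~ S 1 -> (forall x, S x -> S x^-1) -> ~ S' 1 -> (forall x, S' x -> S' x^-1) ->
  universal iota S -> universal iota S' ->
  graph_isomorphic (cayley S) (cayley S').
Proof.
move=> iota_inj iota1 iotaF SH S'H S1 SV S'1 S'V Suniv S'univ.
have loopless T : ~ T 1 -> (forall x, T x -> T x^-1) ->
    symmetric_loopless (fun j k => T ((iota j)^-1 * iota k)).
  move=> T1 TV; split=> [j|j k /TV]; first by rewrite mulVg.
  by rewrite invgM invgK.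
have extension T : universal iota T ->
    extension_property (fun j k => T ((iota j)^-1 * iota k)).
  move=> Tuniv U W UW; have [z [zUW zU zW]] := Tuniv U W (U ++ W) UW.
  by move: zUW; rewrite mem_cat negb_or => /andP[zU' zW']; exists z.
have [f f_bij fE] := back_and_forth _ _ (loopless S S1 SV) (loopless S' S'1 S'V)
  (extension S Suniv) (extension S' S'univ).
exact: (graph_isomorphic_coset_extension iota e f).
Qed.

(** The subgroup generated by a sequence of distinct elements: words in the
    generators and their inverses form a countable type. *)
Lemma exists_countable_subgroup {G : groupType} :
  infinite_set [set: G] ->
  exists iota : nat -> G, [/\ injective iota, exists e, iota e = 1 &
    forall j k, exists m, iota m = (iota j)^-1 * iota k].
Proof.
move=> /infiniteP/card_leP[g].
pose gen n : G := set_val (g (to_setT n)).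
have gen_inj : injective gen.
  by move=> m n /val_inj mn; apply: (congr1 set_val (inj _ _ mn)); rewrite inE.
pose letter (p : bool * nat) := if p.1 then gen p.2 else (gen p.2)^-1.
pose eval w := foldr (fun p x => letter p * x) 1 w.
have eval_cat w w' : eval (w ++ w') = eval w * eval w'.
  by elim: w => [|p w IH] /=; rewrite ?mul1g // IH mulgA.
have evalV w : exists w', eval w' = (eval w)^-1.
  elim: w => [|[b n] w [w' w'E]]; first by exists [::]; rewrite /= invg1.
  exists (w' ++ [:: (~~ b, n)]); rewrite eval_cat w'E /= mulg1 invgM.
  by case: b; rewrite /letter /= ?invgK.
have H_inf : infinite_set (range eval).
  apply: (@sub_infinite_set _ (range gen)).
    by move=> _ [n _ <-]; exists [:: (true, n)] => //; rewrite /= mulg1.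
  move=> gen_fin; apply: infinite_nat.
  apply: (@sub_finite_set _ _ (gen @^-1` range gen)); first by move=> n _; exists n.
  by apply: finite_preimage => // m n _ _; apply: gen_inj.
have : (range eval #= [set: nat])%card.
  rewrite card_eq_le; apply/andP; split; last exact/infiniteP.
  exact: card_le_trans (card_image_le _ _) (countableP _).
rewrite card_eq_sym => /card_bijP[f [f' fK f'K]].
pose iota n := set_val (f (to_setT n)).
have iota_surj w : exists n, iota n = eval w.
  have ew : eval w \in range eval by rewrite inE; exists w.
  exists (set_val (f' (SigSub ew))); rewrite /iota.
  have -> : to_setT (set_val (f' (SigSub ew))) = f' (SigSub ew) by apply: val_inj.
  by rewrite f'K.
have iota_eval n : exists w, iota n = eval w.
  by have := valP (f (to_setT n)); rewrite inE => -[w _ wE]; exists w; rewrite wE.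
exists iota; split.
- by move=> m n /val_inj/(can_inj fK) /(congr1 set_val).
- by have [e eE] := iota_surj [::]; exists e.
- move=> j k; have [w ->] := iota_eval j; have [w' ->] := iota_eval k.
  by have [v <-] := evalV w; rewrite -eval_cat; apply: iota_surj.
Qed.

Lemma finite_torsion_not_CI {G : groupType} :
  (forall x y : G, x * y = y * x) -> infinite_set [set: G] ->
  finite_set (torsion G 2) -> finite_set (torsion G 3) -> ~ CI_group G.
Proof.
move=> G_abelian G_inf G2 G3 CI_G.
have [iota [iota_inj [e iota1] iotaF]] := exists_countable_subgroup G_inf.
have [S [SH S1 SV Ssq Suniv]] :=
  exists_universal_without_squares iota G_abelian iota_inj iotaF G2 G3.
have [c [_ c2 _]] :=
  exists_avoiding_powers iota [::] [:: 1] [::] G_abelian iota_inj G2 G3.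
(* With g ^+ 2 != 1, the four elements to be added all differ from 1. *)
rewrite inE in c2; set g := iota c in c2.
have inH x y : range iota x -> range iota y -> range iota (x^-1 * y).
  by move=> [j _ <-] [k _ <-]; have [m <-] := iotaF j k; exists m.
have H1 : range iota 1 by exists e.
have HV x : range iota x -> range iota x^-1.
  by move=> xH; rewrite -[x^-1]mulg1; apply: inH.
have gH : range iota g by exists c.
have g2H : range iota (g ^+ 2).
  by rewrite expg2 -{1}[g]invgK; apply: inH => //; apply: HV.
have [m0 _ m0E] := HV _ gH; have [m1 _ m1E] := g2H; have [m2 _ m2E] := HV _ g2H.
pose M := [:: c; m0; m1; m2].
pose S' := S `|` [set` map iota M].
have ME : map iota M = [:: g; g^-1; g ^+ 2; (g ^+ 2)^-1] by rewrite /= m0E m1E m2E.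
have S'E x : S' x = (S x \/ x \in [:: g; g^-1; g ^+ 2; (g ^+ 2)^-1]) by rewrite -ME.
have g1 : g != 1 by apply: contraNneq c2 => ->; rewrite expg1n.
have S'1 : ~ S' 1.
  rewrite S'E => -[//|]; rewrite !inE !(eq_sym 1) !invg_eq1.
  by rewrite (negPf g1) (negPf c2).
have S'V x : S' x -> S' x^-1.
  rewrite !S'E => -[/SV|]; first by left.
  rewrite !inE => xM; right.
  by case/or4P: xM => /eqP ->; rewrite ?invgK eqxx ?orbT.
have S'H : S' `<=` range iota.
  by move=> x [/SH//|/mapP[m _ ->]]; exists m.
have iso : graph_isomorphic (cayley S') (cayley S).
  apply: (universal_graph_isomorphic iota e) => //.
  exact: universal_setU.
have S'_conn := connection_setP S' S'1 S'V.
have S_conn := connection_setP S S1 SV.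
have [alpha _ alphaS] := CI_G S' S'_conn S S_conn iso.
have alphaM x : x \in [:: g; g^-1; g ^+ 2; (g ^+ 2)^-1] -> S (alpha x).
  by move=> xM; rewrite -alphaS; exists x; rewrite // S'E; right.
apply: (Ssq (alpha g)); first by apply: alphaM; rewrite inE eqxx.
by rewrite expg2 -gmulfM -expg2; apply: alphaM; rewrite !inE eqxx !orbT.
Qed.

Theorem theorem2p6 (G : groupType)
    (G_abelian : forall x y : G, x * y = y * x)
    (G_infinite : infinite_set [set: G]) :
  ~ CI_group G.
Proof.
have [G2|G2] := pselect (finite_set (torsion G 2)); last exact: infinite_torsion2_not_CI.
have [G3|G3] := pselect (finite_set (torsion G 3)); last exact: infinite_torsion3_not_CI.
exact: finite_torsion_not_CI.
Qed.
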